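(* Let $(R_1,\mathcal L_1)$ and $(R_2,\mathcal L_2)$ be recursive rings with a recursive interpretation of a language. If MRDP holds in $(R_2,\mathcal L_2)$, then every r.e. preserving map $f:R_1\to R_2$ is also a Diophantine map.
   Context: A recursive ring is a ring $R$ with a fixed recursive representation, i.e. an injection $j:R\to\mathbb N$ with recursive image for which addition and multiplication are recursive; subsets of $R^k$ are recursive / recursively enumerable if their images under $j^k$ are. A language $\mathcal L$ (constants, functions, relations; always containing a constant $0$ and equality) has a recursive interpretation in $R$ if all its functions are interpreted by recursive functions and all its relations by recursive sets. Terms are built from constants and variables using functions of $\mathcal L$; basic formulas are $(t_1,\ldots,t_k)\in R'$ with $R'\in\mathcal L$ a $k$-ary relation (possibly equality). $S\subset R^k$ is Diophantine if $S=\{\vec x\in R^k\mid\exists\vec y\in R^l\ (f_1\wedge\cdots\wedge f_r)\}$ for some basic formulas $f_i$. $d:R_1\to R_2$ is a Diophantine map if the coordinatewise image $d(S)\subset R_2^k$ is Diophantine for all $k$ and all Diophantine $S\subset R_1^k$. MRDP holds in $(R,\mathcal L)$ if every recursively enumerable $S\subset R$ is Diophantine in $(R,\mathcal L)$. $f:R_1\to R_2$ is r.e. preserving if $f(S)\subset R_2$ is recursively enumerable for all recursively enumerable $S\subset R_1$.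
   Formalization: ''MRDP holds'' and ''r.e. preserving'' are taken for r.e. subsets of R^k for all k (coordinatewise images), not only for subsets of R; with subsets of R alone the claim is false, e.g. on Z for f(2n)=n, f(2n+1)=X(n) with X a non-recursive 0/1 function. *)

(* Defs.v *)
From mathcomp Require Import all_boot all_order all_algebra.
From mathcomp Require Import boolp classical_sets.

Set Implicit Arguments.
Unset Strict Implicit.
Unset Printing Implicit Defensive.

Import GRing.Theory.

Local Open Scope classical_set_scope.
Local Open Scope ring_scope.

(** ** Partial recursive functions on natural numbers *)

Inductive recfun : nat -> Type :=
  | RZero n : recfun n
  | RSucc : recfun 1
  | RProj n (i : 'I_n) : recfun n
  | RComp m n (f : recfun m) (g : 'I_m -> recfun n) : recfun n
  | RPrim n (f : recfun n) (g : recfun n.+2) : recfun n.+1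
  | RMu n (f : recfun n.+1) : recfun n.

(** [reval c v r]: the computation of [c] on [v] terminates with value [r].
    In [RPrim f g] the recursion argument comes first, and [s] is the sequence
    of intermediate values: [s 0 = f w] and [s i.+1 = g (i, s i, w)].
    In [RMu f] the minimised argument comes first. *)
Fixpoint reval n (c : recfun n) : n.-tuple nat -> nat -> Prop :=
  match c in recfun n return n.-tuple nat -> nat -> Prop with
  | RZero _ => fun _ r => r = 0%N
  | RSucc => fun v r => r = (thead v).+1
  | RProj _ i => fun v r => r = tnth v i
  | RComp m _ f g => fun v r =>
      exists w : m.-tuple nat, (forall i, reval (g i) v (tnth w i)) /\ reval f w r
  | RPrim _ f g => fun v r =>
      let w := behead_tuple v in
      exists s : nat -> nat,
        [/\ reval f w (s 0%N),
            forall i, (i < thead v)%N -> reval g [tuple of i :: s i :: w] (s i.+1)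
          & s (thead v) = r]
  | RMu _ f => fun v r =>
      reval f [tuple of r :: v] 0%N /\
      forall i, (i < r)%N -> exists q, reval f [tuple of i :: v] q.+1
  end.

Definition nat_recursive_fun k (F : k.-tuple nat -> nat) : Prop :=
  exists c : recfun k, forall v, reval c v (F v).

Definition nat_recursive_set k (A : set (k.-tuple nat)) : Prop :=
  nat_recursive_fun (fun v => nat_of_bool `[< A v >]).

(** Empty, or enumerated by a [k]-tuple of total recursive functions. *)
Definition nat_re_set k (A : set (k.-tuple nat)) : Prop :=
  A = set0 \/
  exists2 F : 'I_k -> 1.-tuple nat -> nat,
    forall i, nat_recursive_fun (F i) &
    A = [set [tuple F i [tuple t] | i < k] | t in [set: nat]].

(** ** Recursive rings *)

Section Coded.
Variables (R : Type) (j : R -> nat).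

(** The function induced by [F] on codes is only prescribed on [j(R)^k], so it
    is required to be computed there by some partial recursive function. *)
Definition recursive_fun k (F : k.-tuple R -> R) : Prop :=
  exists c : recfun k, forall x, reval c (map_tuple j x) (j (F x)).

Definition recursive_set k (S : set (k.-tuple R)) : Prop :=
  nat_recursive_set [set map_tuple j x | x in S].

Definition re_set k (S : set (k.-tuple R)) : Prop :=
  nat_re_set [set map_tuple j x | x in S].

End Coded.

Record recursive_representation (R : pzRingType) := RecursiveRepresentation {
  code :> R -> nat;
  code_inj : injective code;
  code_image : nat_recursive_set [set [tuple code x] | x in [set: R]];
  code_add : recursive_fun code
    (fun x : 2.-tuple R => tnth x ord0 + tnth x ord_max);
  code_mul : recursive_fun code
    (fun x : 2.-tuple R => tnth x ord0 * tnth x ord_max)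
}.

(** ** Languages and their interpretations *)

(** Equality belongs to every language; it has no symbol here but its own
    constructor [BEq] of basic formulas. *)
Record language := Language {
  cst_sym : Type;
  cst_zero : cst_sym;
  fun_sym : Type;
  fun_arity : fun_sym -> nat;
  rel_sym : Type;
  rel_arity : rel_sym -> nat
}.

Record interpretation (L : language) (R : pzRingType) := Interpretation {
  interp_cst : cst_sym L -> R;
  interp_fun : forall g : fun_sym L, (fun_arity g).-tuple R -> R;
  interp_rel : forall r : rel_sym L, set ((rel_arity r).-tuple R);
  interp_zero : interp_cst (cst_zero L) = 0
}.

Definition recursive_interpretation (R : pzRingType) (j : R -> nat)
    (L : language) (I : interpretation L R) : Prop :=
  (forall g : fun_sym L, recursive_fun j (@interp_fun L R I g)) /\
  (forall r : rel_sym L, recursive_set j (@interp_rel L R I r)).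

(** Terms and basic formulas in the variables indexed by ['I_n]. *)
Inductive term (L : language) (n : nat) : Type :=
  | TVar (i : 'I_n)
  | TCst (c : cst_sym L)
  | TFun (g : fun_sym L) (t : 'I_(fun_arity g) -> term L n).

Inductive basic_formula (L : language) (n : nat) : Type :=
  | BEq (t u : term L n)
  | BRel (r : rel_sym L) (t : 'I_(rel_arity r) -> term L n).

Section Semantics.
Variables (L : language) (R : pzRingType) (I : interpretation L R).

Fixpoint teval n (x : n.-tuple R) (t : term L n) : R :=
  match t with
  | TVar i => tnth x i
  | TCst c => interp_cst I c
  | TFun g a => @interp_fun L R I g [tuple teval x (a i) | i < fun_arity g]
  end.

Definition bholds n (x : n.-tuple R) (phi : basic_formula L n) : Prop :=
  match phi with
  | BEq t u => teval x t = teval x u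
  | BRel r a => @interp_rel L R I r [tuple teval x (a i) | i < rel_arity r]
  end.

Definition diophantine k (S : set (k.-tuple R)) : Prop :=
  exists (l r : nat) (phi : 'I_r -> basic_formula L (k + l)),
    S = [set x : k.-tuple R | exists y : l.-tuple R,
         forall i, bholds [tuple of x ++ y] (phi i)].

End Semantics.

Definition diophantine_map (R1 R2 : pzRingType) (L1 L2 : language)
    (I1 : interpretation L1 R1) (I2 : interpretation L2 R2)
    (d : R1 -> R2) : Prop :=
  forall k (S : set (k.-tuple R1)),
    diophantine I1 S -> diophantine I2 [set map_tuple d x | x in S].

(** The next two notions are taken for subsets of [R^k] for all [k], as in
    [diophantine_map], and not only for [k = 1].  Preserving r.e. sets for
    [k = 1] does not control images of r.e. sets of pairs: on the integers, the
    map [2n |-> n] and [2n+1 |-> X n], with [X] the characteristic function of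
    a non-recursive set, preserves r.e. subsets of [Z] but maps the set of pairs
    [(2n, 2n+1)] to the graph of [X].  Likewise, since a language need not
    contain the ring operations, r.e. subsets of [R] may all be Diophantine
    while some r.e. subset of [R^2] is not. *)

Definition MRDP (R : pzRingType) (j : R -> nat) (L : language)
    (I : interpretation L R) : Prop :=
  forall k (S : set (k.-tuple R)), re_set j S -> diophantine I S.

Definition re_preserving (R1 R2 : pzRingType) (j1 : R1 -> nat) (j2 : R2 -> nat)
    (f : R1 -> R2) : Prop :=
  forall k (S : set (k.-tuple R1)),
    re_set j1 S -> re_set j2 [set map_tuple f x | x in S].

(* Main.v *)
Require Import Defs.
From mathcomp Require Import all_boot all_order all_algebra.
From mathcomp Require Import boolp classical_sets.

(** Diophantine sets of a recursive ring with a recursive interpretation are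
    recursively enumerable ([diophantine_re]).  Granted this, the theorem is
    immediate: if [S] is Diophantine then it is r.e., so its image under an
    r.e. preserving map is r.e., hence Diophantine by MRDP in the target.

    Let [S] be the set of those [x] for which some [y] makes finitely many basic
    formulas true at [x ++ y].  If [S] is empty there is nothing to prove;
    otherwise fix a solution [z0].  The tuples [z = x ++ y] can be enumerated
    recursively ([tuple_enumeration]): natural numbers are unpaired with the
    help of integer square roots, and numbers that are not codes of ring
    elements are replaced by the code of [0].  Along this enumeration terms take
    recursive values ([recursive_teval]), so that the truth of the formulas is
    decidable ([decidable_bholds]).  The map sending a number to the first
    coordinates of the tuple it stands for if this tuple is a solution, and to
    those of [z0] otherwise, then enumerates [S].

    The functions computing on codes of ring elements are only known to
    terminate on such codes; they are always composed with enumerations of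
    codes, so that every function on natural numbers met below is total. *)

Set Implicit Arguments.
Unset Strict Implicit.
Unset Printing Implicit Defensive.

Local Open Scope classical_set_scope.
Local Open Scope nat_scope.

(** * Closure properties of the total recursive functions *)

(** The code [c] need not terminate everywhere, only on the values of the total
    functions [G]. *)
Lemma recursive_reval_comp n m (c : recfun m) (G : 'I_m -> n.-tuple nat -> nat)
    (H : n.-tuple nat -> nat) :
  (forall i, nat_recursive_fun (G i)) ->
  (forall v, reval c [tuple G i v | i < m] (H v)) ->
  nat_recursive_fun H.
Proof.
move=> /choice[g gP] cH.
exists (RComp c g) => v /=; exists [tuple G i v | i < m]; split=> // i.
by rewrite tnth_mktuple.
Qed.

Lemma recursive_comp n m (F : m.-tuple nat -> nat)
    (G : 'I_m -> n.-tuple nat -> nat) :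
  nat_recursive_fun F -> (forall i, nat_recursive_fun (G i)) ->
  nat_recursive_fun (fun v => F [tuple G i v | i < m]).
Proof. by move=> [c cF] Grec; exact: (recursive_reval_comp Grec). Qed.

Lemma eq_recursive n (F G : n.-tuple nat -> nat) :
  F =1 G -> nat_recursive_fun F -> nat_recursive_fun G.
Proof. by move=> FG [c cF]; exists c => v; rewrite -FG. Qed.

(** The variables of recursive functions, written [nth 0 v i]; indices out of
    range give the constant [0]. *)
Lemma recursive_nth n i : nat_recursive_fun (fun v : n.-tuple nat => nth 0 v i).
Proof.
have [lt_in|le_ni] := ltnP i n.
  by exists (RProj (Ordinal lt_in)) => v /=; rewrite (tnth_nth 0).
by exists (RZero n) => v /=; rewrite nth_default ?size_tuple.
Qed.

Definition recursive1 (h : nat -> nat) :=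
  nat_recursive_fun (fun v : 1.-tuple nat => h (nth 0 v 0)).

Definition recursive2 (h : nat -> nat -> nat) :=
  nat_recursive_fun (fun v : 2.-tuple nat => h (nth 0 v 0) (nth 0 v 1)).

Lemma recursive_comp1 h n (F : n.-tuple nat -> nat) :
  recursive1 h -> nat_recursive_fun F -> nat_recursive_fun (fun v => h (F v)).
Proof.
move=> hrec Frec.
have := recursive_comp hrec (fun _ : 'I_1 => Frec).
by apply: eq_recursive => v; rewrite (nth_mktuple _ _ (@Ordinal 1 0 isT)).
Qed.

Lemma recursive_comp2 h n (F G : n.-tuple nat -> nat) :
  recursive2 h -> nat_recursive_fun F -> nat_recursive_fun G ->
  nat_recursive_fun (fun v => h (F v) (G v)).
Proof.
move=> hrec Frec Grec.
pose FG (i : 'I_2) := if i == 0 :> nat then F else G.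
have FGrec i : nat_recursive_fun (FG i) by rewrite /FG; case: ifP.
have := recursive_comp hrec FGrec; apply: eq_recursive => v.
by rewrite (nth_mktuple _ _ (@Ordinal 2 0 isT))
           (nth_mktuple _ _ (@Ordinal 2 1 isT)).
Qed.

Lemma recursive1_succ : recursive1 succn.
Proof. by exists RSucc => -[[|a [|]]] //= i; rewrite (tnth_nth 0). Qed.

Lemma recursive_cst n a : nat_recursive_fun (fun _ : n.-tuple nat => a).
Proof.
elim: a => [|a IHa]; first by exists (RZero n).
exact: recursive_comp1 recursive1_succ IHa.
Qed.

(** Primitive recursion on the first variable, with the others as parameters. *)
Lemma recursive_prim n (F : n.-tuple nat -> nat) (G : n.+2.-tuple nat -> nat)
    (s : n.-tuple nat -> nat -> nat) :
  nat_recursive_fun F -> nat_recursive_fun G ->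
  (forall w, s w 0 = F w) ->
  (forall w i, s w i.+1 = G [tuple of i :: s w i :: w]) ->
  nat_recursive_fun (fun v : n.+1.-tuple nat => s (behead_tuple v) (thead v)).
Proof.
move=> [cF cFP] [cG cGP] s0 sS; exists (RPrim cF cG) => v /=.
exists (s (behead_tuple v)); split=> //; first by rewrite s0.
by move=> i _; rewrite sS.
Qed.

Lemma recursive1_prim (h : nat -> nat) (g : nat -> nat -> nat) :
  recursive2 g -> (forall a, h a.+1 = g a (h a)) -> recursive1 h.
Proof.
move=> grec hS.
have := @recursive_prim 0 (fun=> h 0)
  (fun v => g (nth 0 v 0) (nth 0 v 1)) (fun=> h)
  (recursive_cst _ _) grec (fun=> erefl) (fun _ i => hS i).
by apply: eq_recursive => v; rewrite /thead (tnth_nth 0).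
Qed.

Lemma recursive2_prim (h : nat -> nat -> nat) (g : nat -> nat -> nat -> nat) :
  recursive1 (h 0) ->
  nat_recursive_fun
    (fun v : 3.-tuple nat => g (nth 0 v 0) (nth 0 v 1) (nth 0 v 2)) ->
  (forall a b, h a.+1 b = g a (h a b) b) -> recursive2 h.
Proof.
move=> h0rec grec hS.
have := @recursive_prim 1 _ _ (fun w i => h i (nth 0 w 0))
  h0rec grec (fun=> erefl) (fun w i => hS i (nth 0 w 0)).
by apply: eq_recursive => v; rewrite /thead (tnth_nth 0) /= nth_behead.
Qed.

(** * Arithmetic *)

Lemma recursive2_add : recursive2 addn.
Proof.
apply: (@recursive2_prim _ (fun _ r _ => r.+1)) => //.
- exact: recursive_nth.
- exact: recursive_comp1 recursive1_succ (recursive_nth _ _).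
Qed.

Lemma recursive2_mul : recursive2 muln.
Proof.
apply: (@recursive2_prim _ (fun _ r b => b + r)) => //.
- exact: recursive_cst.
- exact: recursive_comp2 recursive2_add (recursive_nth _ _) (recursive_nth _ _).
Qed.

Lemma recursive1_pred : recursive1 predn.
Proof. by apply: (@recursive1_prim _ (fun a _ => a)) => //; exact: recursive_nth. Qed.

Lemma recursive2_sub : recursive2 subn.
Proof.
have subCrec : recursive2 (fun b a => a - b).
  apply: (@recursive2_prim _ (fun _ r _ => r.-1)) => //.
  - by under [X in recursive1 X]eq_fun do rewrite subn0; exact: recursive_nth.
  - exact: recursive_comp1 recursive1_pred (recursive_nth _ _).
  - by move=> a b; rewrite subnS.
exact: recursive_comp2 subCrec (recursive_nth _ 1) (recursive_nth _ 0).
Qed.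

(** * Decidable predicates *)

Definition decidable_pred n (P : n.-tuple nat -> Prop) :=
  nat_recursive_fun (fun v => nat_of_bool `[< P v >]).

Lemma decidable_eq n (F G : n.-tuple nat -> nat) :
  nat_recursive_fun F -> nat_recursive_fun G ->
  decidable_pred (fun v => F v = G v).
Proof.
move=> Frec Grec.
have subrec := recursive_comp2 recursive2_sub.
have := subrec _ _ _ (recursive_cst _ 1)
  (recursive_comp2 recursive2_add (subrec _ _ _ Frec Grec)
                                  (subrec _ _ _ Grec Frec)).
apply: eq_recursive => v; have [->|neqFG] := eqVneq (F v) (G v).
  by rewrite subnn asboolT.
rewrite asboolF; last exact/eqP.
by move: neqFG; rewrite eqn_leq -!subn_eq0 -addn_eq0; case: (_ + _).
Qed.

Lemma decidable_le n (F G : n.-tuple nat -> nat) :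
  nat_recursive_fun F -> nat_recursive_fun G ->
  decidable_pred (fun v => F v <= G v).
Proof.
move=> Frec Grec.
have := decidable_eq (recursive_comp2 recursive2_sub Frec Grec)
                     (recursive_cst _ 0).
apply: eq_recursive => v; congr nat_of_bool.
by apply: asbool_equiv_eq; rewrite -subn_eq0; split=> /eqP.
Qed.

Lemma decidable_and n (P Q : n.-tuple nat -> Prop) :
  decidable_pred P -> decidable_pred Q -> decidable_pred (fun v => P v /\ Q v).
Proof.
move=> Pdec Qdec; have := recursive_comp2 recursive2_mul Pdec Qdec.
by apply: eq_recursive => v; rewrite asbool_and mulnb.
Qed.

Lemma decidable_forall n r (P : 'I_r -> n.-tuple nat -> Prop) :
  (forall i, decidable_pred (P i)) -> decidable_pred (fun v => forall i, P i v).
Proof.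
elim: r P => [|r IHr] P Pdec.
  by apply: eq_recursive (recursive_cst n 1) => v; rewrite asboolT // => -[].
have := decidable_and (Pdec ord0) (IHr _ (fun i => Pdec (lift ord0 i))).
apply: eq_recursive => v; congr nat_of_bool; apply: asbool_equiv_eq.
split=> [[P0 PS] i|Pi]; last by split=> // i; exact: Pi.
by case: (unliftP ord0 i) => [k|] ->.
Qed.

Lemma recursive_if n (P : n.-tuple nat -> Prop) (F G : n.-tuple nat -> nat) :
  decidable_pred P -> nat_recursive_fun F -> nat_recursive_fun G ->
  nat_recursive_fun (fun v => if `[< P v >] then F v else G v).
Proof.
move=> Pdec Frec Grec.
have mulrec := recursive_comp2 recursive2_mul.
have notP := recursive_comp2 recursive2_sub (recursive_cst n 1) Pdec.
have := recursive_comp2 recursive2_add (mulrec _ _ _ Pdec Frec)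
                                       (mulrec _ _ _ notP Grec).
by apply: eq_recursive => v; case: `[< _ >]; rewrite ?mul1n ?mul0n ?addn0.
Qed.

(** * Recursive enumeration of tuples of natural numbers *)

(** Integer square root, by primitive recursion; [isqrtP] characterizes it.  The
    test is a reflected proposition, as in [recursive_if]. *)
Fixpoint isqrt t :=
  if t is t'.+1 then
    if `[< (isqrt t').+1 * (isqrt t').+1 <= t'.+1 >] then (isqrt t').+1
    else isqrt t'
  else 0.

Lemma isqrtP t : isqrt t * isqrt t <= t < (isqrt t).+1 * (isqrt t).+1.
Proof.
elim: t => //= t /andP[IHl IHr]; case: asboolP => [-> //|/negP] /=.
  by apply: leq_ltn_trans IHr _; rewrite ltn_mul.
by rewrite -ltnNge => ->; rewrite (leq_trans IHl).
Qed.

Lemma isqrt_eq s t : s * s <= t < s.+1 * s.+1 -> isqrt t = s.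
Proof.
move=> /andP[sl sr]; have /andP[il ir] := isqrtP t.
apply/eqP; rewrite eqn_leq; apply/andP; split; rewrite leqNgt; apply/negP => h.
  by have := leq_trans sr (leq_trans (leq_mul h h) il); rewrite ltnn.
by have := leq_trans ir (leq_trans (leq_mul h h) sl); rewrite ltnn.
Qed.

Lemma recursive1_isqrt : recursive1 isqrt.
Proof.
apply: (@recursive1_prim _
  (fun t s => if `[< s.+1 * s.+1 <= t.+1 >] then s.+1 else s)) => //.
have srec i := recursive_comp1 recursive1_succ (@recursive_nth 2 i).
apply: recursive_if (srec 1) (recursive_nth _ 1).
exact: decidable_le (recursive_comp2 recursive2_mul (srec 1) (srec 1)) (srec 0).
Qed.

(** The two components of the pair coded by [t], where [(a, b)] is coded by
    [(a + b) ^ 2 + a]. *)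
Definition unpairl t := t - isqrt t * isqrt t.
Definition unpairr t := isqrt t - unpairl t.

Lemma unpair_surj a b : exists t, unpairl t = a /\ unpairr t = b.
Proof.
exists ((a + b) * (a + b) + a).
have sq : isqrt ((a + b) * (a + b) + a) = a + b.
  have := leq_addr b a; move: (a + b) => c le_ac.
  apply: isqrt_eq; rewrite leq_addr mulSn mulnS addnA addnC ltn_add2r.
  by rewrite addSn ltnS (leq_trans le_ac) ?leq_addr.
by rewrite /unpairr /unpairl sq !addKn.
Qed.

Lemma recursive1_unpairl : recursive1 unpairl.
Proof.
apply: recursive_comp2 recursive2_sub (recursive_nth _ 0) _.
exact: recursive_comp2 recursive2_mul recursive1_isqrt recursive1_isqrt.
Qed.

Lemma recursive1_unpairr : recursive1 unpairr.
Proof.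
exact: recursive_comp2 recursive2_sub recursive1_isqrt recursive1_unpairl.
Qed.

(** The [i]-th entry of the sequence coded by [t]: a sequence is coded as the pair
    of its head and the code of its tail. *)
Definition decode_nth i t := unpairl (iter i unpairr t).

Lemma recursive1_decode_nth i : recursive1 (decode_nth i).
Proof.
apply: recursive_comp1 recursive1_unpairl _.
elim: i => [|i IHi] /=; first exact: recursive_nth.
exact: recursive_comp1 recursive1_unpairr IHi.
Qed.

Lemma decode_nth_surj (s : seq nat) :
  exists t, forall i, i < size s -> decode_nth i t = nth 0 s i.
Proof.
elim: s => [|a s [t tP]]; first by exists 0.
have [u [ul ur]] := unpair_surj a t; exists u => -[|i] //= lt_is.
by rewrite /decode_nth iterSr ur; exact: tP.
Qed.

(** * Diophantine sets are recursively enumerable *)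

Lemma map_tuple_inj n (T U : Type) (j : T -> U) :
  injective j -> injective (map_tuple j : n.-tuple T -> n.-tuple U).
Proof. by move=> jinj x y /(congr1 val) /(inj_map jinj) /val_inj. Qed.

Lemma mktuple_comp n (T U : Type) (j : T -> U) (F : 'I_n -> T) :
  [tuple j (F i) | i < n] = map_tuple j [tuple F i | i < n].
Proof.
by apply: eq_from_tnth => i; rewrite tnth_mktuple tnth_map tnth_mktuple.
Qed.

Section RecursiveRing.
Variables (R : pzRingType) (j : recursive_representation R).

Lemma ring_enumeration :
  exists2 e : nat -> R, recursive1 (fun t => j (e t)) &
    forall x, exists t, e t = x.
Proof.
(* Outside the image of [j], the value is reset to [0]. *)
have eP t : exists x, j x = if `[< exists y, j y = t >] then t else j 0%R.
  by case: asboolP => [//|_]; exists 0%R.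
have [e je] := choice eP; exists e => [|x]; last first.
  exists (j x); apply: (@code_inj _ j); rewrite je asboolT //; by exists x.
have := recursive_if (code_image j) (recursive_nth _ 0) (recursive_cst 1 (j 0%R)).
apply: eq_recursive => v; rewrite je; congr (if _ then _ else _).
apply: asbool_equiv_eq; split=> [[x _ <-]|[x xv]]; first by exists x.
exists x => //; apply: val_inj => /=; rewrite xv.
by case: v {xv} => -[|a []].
Qed.

(** A family of [n]-tuples of ring elements indexed by [nat] whose coordinates
    have recursive codes. *)
Definition recursive_family n (z : nat -> n.-tuple R) :=
  forall i, recursive1 (fun t => j (tnth (z t) i)).

Lemma tuple_enumeration n :
  exists2 z : nat -> n.-tuple R, recursive_family z & forall x, exists t, z t = x.
Proof.
have [e erec esurj] := ring_enumeration.
exists (fun t => [tuple e (decode_nth i t) | i < n]) => [i|x].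
  have := recursive_comp1 erec (recursive1_decode_nth i).
  by apply: eq_recursive => v; rewrite tnth_mktuple.
have [s sP] := choice esurj.
have [t tP] := decode_nth_surj (map s x); exists t.
apply: eq_from_tnth => i; have lt_i : i < size x by rewrite size_tuple.
rewrite tnth_mktuple tP ?size_map // (nth_map (tnth x i)) // sP.
by rewrite -tnth_nth.
Qed.

Variables (L : language) (I : interpretation L R).
Hypothesis Irec : recursive_interpretation j I.

Lemma recursive_teval n (z : nat -> n.-tuple R) (t : term L n) :
  recursive_family z -> recursive1 (fun a => j (teval I (z a) t)).
Proof.
move=> zrec; elim: t => [i|c|g a IHa] /=; first exact: zrec.
  exact: recursive_cst.
have [c cP] := Irec.1 g.
apply: (recursive_reval_comp (c := c) IHa) => v.
by rewrite mktuple_comp; exact: cP.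
Qed.

Lemma decidable_bholds n (z : nat -> n.-tuple R) (phi : basic_formula L n) :
  recursive_family z ->
  decidable_pred (fun v : 1.-tuple nat => bholds I (z (nth 0 v 0)) phi).
Proof.
move=> zrec; case: phi => [t u|r a] /=.
  have := decidable_eq (recursive_teval t zrec) (recursive_teval u zrec).
  apply: eq_recursive => v; congr nat_of_bool.
  by apply: asbool_equiv_eq; split=> [/code_inj|->].
have := recursive_comp (Irec.2 r) (fun i => recursive_teval (a i) zrec).
apply: eq_recursive => v; congr nat_of_bool; apply: asbool_equiv_eq.
rewrite mktuple_comp.
split=> [[x rx /(map_tuple_inj (@code_inj _ j)) <- //]|rx].
by eexists; first exact: rx.
Qed.

Lemma diophantine_re k (S : set (k.-tuple R)) : diophantine I S -> re_set j S.
Proof.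
move=> [l [r [phi ->]]]; set S' := (X in re_set _ X).
have [[x0 [y0 sol0]]|noS] := pselect (exists x, S' x); last first.
  by left; apply/seteqP; split=> // t [x Sx _]; apply: noS; exists x.
right; have [z zrec zsurj] := tuple_enumeration (k + l).
pose sol t := forall i, bholds I (z t) (phi i).
pose z' t := if `[< sol t >] then z t else [tuple of x0 ++ y0].
have z'sol t i : bholds I (z' t) (phi i).
  by rewrite /z'; case: asboolP => [solt|_]; [exact: solt|exact: sol0].
have z'rec : recursive_family z'.
  move=> i; have := recursive_if
    (decidable_forall (fun i => decidable_bholds (phi i) zrec))
    (zrec i) (recursive_cst 1 (j (tnth [tuple of x0 ++ y0] i))).
  by apply: eq_recursive => v; rewrite /z' /sol; case: ifP.
exists (fun i v => j (tnth (z' (nth 0 v 0)) (lshift l i))).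
  by move=> i; exact: z'rec.
apply/seteqP; split=> [_ [x [y xy] <-]|_ [t _ <-]].
  have [t zt] := zsurj [tuple of x ++ y]; exists t => //.
  apply: eq_from_tnth => i; rewrite tnth_mktuple tnth_map /z' asboolT.
    by rewrite /= zt tnth_lshift.
  by move=> i'; rewrite zt.
(* Split the solution [z' t] into its first [k] and last [l] coordinates. *)
pose x := [tuple tnth (z' t) (lshift l i) | i < k].
pose y := [tuple tnth (z' t) (rshift k i) | i < l].
have z'E : z' t = [tuple of x ++ y].
  apply: eq_from_tnth => i; case: (split_ordP i) => i' ->.
    by rewrite tnth_lshift tnth_mktuple.
  by rewrite tnth_rshift tnth_mktuple.
exists x; first by exists y => i; rewrite -z'E.
by rewrite -mktuple_comp.
Qed.

End RecursiveRing.

Theorem lemma6p22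
    (R1 R2 : pzRingType)
    (j1 : recursive_representation R1) (j2 : recursive_representation R2)
    (L1 L2 : language)
    (I1 : interpretation L1 R1) (I2 : interpretation L2 R2)
    (hI1 : recursive_interpretation j1 I1)
    (hI2 : recursive_interpretation j2 I2)
    (hMRDP : MRDP j2 I2)
    (f : R1 -> R2) (hf : re_preserving j1 j2 f) :
  diophantine_map I1 I2 f.
Proof.
by move=> k S dS; apply/hMRDP/hf; exact: diophantine_re hI1 _ _ dS.
Qed.
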